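(* Let $b,\Delta\in R=\mathbb{F}_{2^n}[T]$ with $b\neq0$ and $\Delta\notin\varphi(R)$, where $\varphi(t)=t^2+bt$. The kernel of the homomorphism $\omega:C(b,\Delta)\to(R/(b^2))^*/H$, $C\mapsto H_C$, is $C(b,\Delta)^2=\{C^2 : C\in C(b,\Delta)\}$.
   Context: $R=\mathbb{F}_{2^n}[T]$. The triple $(a,b,c)\in R^3$ denotes the binary quadratic form $ax^2+bxy+cy^2$; it is primitive if $a,b,c$ have no common non-unit divisor. Fix a subgroup $G$ of $(\mathbb{F}_{2^n},+)$ with $\#G=2^{n-1}$ and $1\notin G$, and set $R_b=\{qb+r : q,r\in R,\ \deg r<\deg b,\ q(0)\in G\}$ (with $\deg0=-\infty$), a subgroup of $(R,+)$ such that for every $k\in R$ exactly one of $k,k+b$ lies in $R_b$. For $\gamma=\begin{pmatrix} p & q \\ r & s \end{pmatrix}\in Sl_2(R)$ put $\gamma(a,b,c)=(ap^2+bpq+cq^2,\ b,\ ar^2+brs+cs^2)$. Primitive forms $(a,b,c)$ and $(A,b,C)$ are properly equivalent if there is such a $\gamma$ with $\gamma(a,b,c)=(A,b,C)$ and $apr+bqr+cqs\in R_b$. This is an equivalence relation; $[(a,b,c)]$ denotes the class. $C(b,\Delta)=\{[(a,b,c)] : (a,b,c)\text{ primitive},\ a,c\in R,\ ac\equiv\Delta\bmod\varphi(R)\}$. A form $(a_3,b,c_3)$ is a direct composition of $(a_1,b,c_1)$ and $(a_2,b,c_2)$ if there exist $p_i,q_i,r_i,s_i\in R$ ($i=1,2$)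 such that, as polynomials in $x,y,z,w$, $$(a_1x^2+bxy+c_1y^2)(a_2z^2+bzw+c_2w^2)=a_3L_1^2+bL_1L_2+c_3L_2^2,\quad L_i=p_ixz+q_ixw+r_iyz+s_iyw,$$ and $q_1r_2+q_2r_1\in R_b$, $p_2s_1+q_2r_1\in R_b$. Direct composition makes $C(b,\Delta)$ a finite Abelian group via $[(a_1,b,c_1)][(a_2,b,c_2)]=[(a_3,b,c_3)]$, with identity $C_0=[(1,b,\Delta)]$. An element $m\in R$ is represented by $(a,b,c)$ if $m=ax^2+bxy+cy^2$ for some $x,y\in R$; a residue class $[m]\in(R/(b^2))^*$ is represented by $(a,b,c)$ if some element of $[m]$ is. Representation depends only on the proper equivalence class. $H\subset(R/(b^2))^*$ is the set of residue classes represented by $C_0$, which is a subgroup; for $C\in C(b,\Delta)$, $H_C\subset(R/(b^2))^*$ is the set of residue classes represented by $C$, which is a coset of $H$. The map $\omega:C\mapsto H_C$ is a group homomorphism. *)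

(* Defs.v *)
From mathcomp Require Import all_boot all_order all_algebra.
From mathcomp Require Import boolp classical_sets.
From mathcomp Require Import mpoly.

Set Implicit Arguments.
Unset Strict Implicit.
Unset Printing Implicit Defensive.

Import GRing.Theory.
Local Open Scope classical_set_scope.
Local Open Scope ring_scope.

(* [Bqf a b c] is the binary quadratic form a x^2 + b x y + c y^2. *)
Record bqf (R : Type) : Type := Bqf { qa : R; qb : R; qc : R }.

Section BinaryQuadraticForms.

Variable F : finFieldType.
Local Notation R := {poly F}.
Implicit Types (G : {set F}) (f g : bqf R) (C : set (bqf R)) (b D m : R).

Definition phi b (t : R) : R := t ^+ 2 + b * t.

(* The degree condition [deg r < deg b], with [deg 0 = -oo], is stated with
   [size], which is the degree plus one, and 0 for the zero polynomial. *)
Definition Rb G b : set R :=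
  [set k | exists q r : R,
     [/\ k = q * b + r, (size r < size b)%N & q.[0] \in G]].

Definition primitive f : Prop :=
  forall d : R, d %| qa f -> d %| qb f -> d %| qc f -> d \is a GRing.unit.

Definition bqf_eval (S : comPzRingType) (a b c x y : S) : S :=
  a * x ^+ 2 + b * x * y + c * y ^+ 2.

Definition bqf_act (u : 'M[R]_2) f : bqf R :=
  Bqf (bqf_eval (qa f) (qb f) (qc f) (u 0 0) (u 0 1))
      (qb f)
      (bqf_eval (qa f) (qb f) (qc f) (u 1 0) (u 1 1)).

Definition proper_equiv G f g : Prop :=
  exists u : 'M[R]_2,
    [/\ \det u = 1, bqf_act u f = g
      & Rb G (qb f) (qa f * u 0 0 * u 1 0 + qb f * u 0 1 * u 1 0
                     + qc f * u 0 1 * u 1 1)].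

Definition class_of G f : set (bqf R) :=
  [set g | primitive g /\ proper_equiv G f g].

Definition class_group G b D : set (set (bqf R)) :=
  [set class_of G f | f in
     [set f | [/\ primitive f, qb f = b
                & exists t : R, qa f * qc f - D = phi b t]]].

(* The composition identity is an equality in R[x, y, z, w], the variables
   x, y, z, w being 'X_0, 'X_1, 'X_2, 'X_3. *)
Definition direct_composition G f1 f2 f3 : Prop :=
  qb f1 = qb f3 /\ qb f2 = qb f3 /\
  exists p1 q1 r1 s1 p2 q2 r2 s2 : R,
  let P := {mpoly R[4]} in
  let x : P := 'X_(inord 0) in
  let y : P := 'X_(inord 1) in
  let z : P := 'X_(inord 2) in
  let w : P := 'X_(inord 3) in
  let L (p q r s : R) : P :=
    p%:MP * x * z + q%:MP * x * w + r%:MP * y * z + s%:MP * y * w in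
  let ev f (u v : P) : P :=
    bqf_eval (qa f)%:MP (qb f)%:MP (qc f)%:MP u v in
  [/\ ev f1 x y * ev f2 z w = ev f3 (L p1 q1 r1 s1) (L p2 q2 r2 s2),
      Rb G (qb f3) (q1 * r2 + q2 * r1)
    & Rb G (qb f3) (p2 * s1 + q2 * r1)].

(* The union of the classes of all direct compositions of a member of C1 and
   a member of C2.  For C1, C2 in [class_group G b D] these classes coincide,
   so that [f1][f2] = [f3] for every direct composition f3 of f1 and f2. *)
Definition class_mul G (C1 C2 : set (bqf R)) : set (bqf R) :=
  [set g | exists f1 f2 f3,
     [/\ C1 f1, C2 f2, direct_composition G f1 f2 f3 & class_of G f3 g]].

Definition class_squares G b D : set (set (bqf R)) :=
  [set class_mul G C C | C in class_group G b D].

Definition class_one G b D : set (bqf R) := class_of G (Bqf 1 b D).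

Definition residue b m : set R := [set m' | b ^+ 2 %| m' - m].

(* (R/(b^2))^*, residue classes being subsets of R; the definition also makes
   sense when b is constant, in which case R/(b^2) is the zero ring. *)
Definition unit_residues b : set (set R) :=
  [set residue b m | m in [set m | exists u : R, b ^+ 2 %| m * u - 1]].

Definition represents f m : Prop :=
  exists x y : R, m = bqf_eval (qa f) (qb f) (qc f) x y.

(* The homomorphism omega : C |-> H_C. *)
Definition omega b C : set (set R) :=
  [set r | unit_residues b r /\
           exists f m, [/\ C f, r m & represents f m]].

(* The subgroup H, which is the identity of the quotient (R/(b^2))^*/H, whose
   elements are cosets of H. *)
Definition H_sub G b D : set (set R) := omega b (class_one G b D).

Definition omega_kernel G b D : set (set (bqf R)) :=
  [set C | class_group G b D C /\ omega b C = H_sub G b D].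

End BinaryQuadraticForms.

(* Main.v *)
Require Import Defs.
From mathcomp Require Import all_boot all_order all_algebra all_field.
From mathcomp Require Import boolp classical_sets.
From mathcomp Require Import ring zify mpoly.

(** Write N for the norm form (1, b, Delta), and R for the ring F[T].

    Squares lie in the kernel.  A square class contains a form h that takes
    a value k^2 with k prime to b: a primitive form takes a value k prime to b,
    its class then contains (k, b, k c) or (k c, b, k), and composing that form
    with itself gives (k^2, b, c) or (c, b, k^2) ([square_composition]).  Over
    the order R[theta] with theta^2 + b theta + Delta = 0, the value at a point
    of h times the value at another is a value of N, and a value of N times a
    value of h is a value of h.  When one of the values of h is k^2, which can
    be divided out modulo b^2, the forms h and N represent the same residues
    ([omega_square]).

    The kernel consists of squares.  A class in the kernel represents the
    residue 1, so a form in it takes a value congruent to a square h^2, with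
    h prime to b, at a coprime point ([primitive_point]).  In coordinates that
    put this point first, the form is (h^2 + b^2 e, b, c).  Substituting b y
    for y turns it into (h x)^2 + b^2 (e x^2 + x y + c y^2), and here is the
    arithmetic heart: e x^2 + x y + c y^2 is, up to the square of a linear
    form, a product of two linear forms with determinant 1
    ([split_ternary]).  This is the vanishing of the Brauer group of the
    affine line over a perfect field, in the case of quaternion algebras; it
    has a short proof by descent on the degrees of e and c, since a leading
    term of odd size is that of a square, and two leading terms of even size
    cancel after a translation of x.  Hence the form takes a square value
    m^2 at a coprime point, and a choice of that point makes m prime to b
    ([represents_square]).  So the class contains (m^2, b, c) or (c, b, m^2),
    which is the square of the class of (m, b, m c) or (m c, b, m).

    The alternatives above are caused by the set R_b, which picks
    one of the two orientations of a form: exchanging the two variables has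
    determinant 1 in characteristic 2 and moves the twist by b, so that one of
    the two orders gives a proper equivalence, and both serve
    ([equiv_value_or_swap]).

    The product of two classes is by definition a union over all direct
    compositions, so it has to be shown to be one class.  In characteristic 2
    the polar form of (a, b, c) is b times the determinant, and a composition
    identity says exactly that the three forms are those of a 2 x 4 matrix
    ([direct_compositionP]), the coefficients of the first two being its
    minors.  The conditions on R_b determine all minors, two
    unimodular matrices with equal minors differ by an element of SL_2, and
    that element carries one composed form to the other ([composes_uniq]). *)

Set Implicit Arguments.
Unset Strict Implicit.
Unset Printing Implicit Defensive.

Import GRing.Theory.
Local Open Scope ring_scope.

(** Polynomial identities modulo 2: the integral difference of the two sides
    has even coefficients, and the equations 2 = 4 = 6 = 0, with their
    opposites, cancel those that occur. *)
Ltac char2_evens two0 tac :=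
  match type of two0 with
  | @eq ?S _ _ =>
    let E2 := fresh in let E4 := fresh in let E6 := fresh in
    let E2' := fresh in let E4' := fresh in let E6' := fresh in
    assert (E4 : 4 = 0 :> S) by (rewrite -[4%N]/(2 * 2)%N natrM two0 mul0r //);
    assert (E6 : 6 = 0 :> S) by (rewrite -[6%N]/(2 * 3)%N natrM two0 mul0r //);
    assert (E2' : - 2 = 0 :> S) by (rewrite two0 oppr0 //);
    assert (E4' : - 4 = 0 :> S) by (rewrite E4 oppr0 //);
    assert (E6' : - 6 = 0 :> S) by (rewrite E6 oppr0 //);
    apply: subr0_eq; tac two0 E4 E6 E2' E4' E6'
  end.

Tactic Notation "char2_ring" constr(two0) :=
  char2_evens two0 ltac:(fun a b c d e f => ring: a b c d e f).

(** * Finite fields of characteristic 2 *)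

Section FiniteFieldChar2.
Variables (n : nat) (F : finFieldType) (cardF : #|F| = (2 ^ n)%N).

Lemma char2_log_gt0 : (0 < n)%N.
Proof.
by case: n cardF (finNzRing_gt1 F) => // ->.
Qed.

Lemma char2_two0 : 2 = 0 :> F.
Proof.
have := expf_card (-1 : F); rewrite cardF -signr_odd oddX eqn0Ngt char2_log_gt0 /=.
by rewrite expr0 => e; rewrite -[2]/(1 + 1) [X in X + _]e addNr.
Qed.

Lemma char2_sqrt (x : F) : exists y, y ^+ 2 = x.
Proof.
exists (x ^+ (2 ^ n.-1)).
by rewrite -exprM -expnSr prednK ?char2_log_gt0 // -cardF expf_card.
Qed.

Lemma char2_poly_two0 : 2 = 0 :> {poly F}.
Proof. by rewrite -polyC_natr char2_two0. Qed.

End FiniteFieldChar2.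

(** * Splitting a form of discriminant 1, and coprime values *)

Section SplitTernary.
Variable F : finFieldType.
Local Notation R := {poly F}.
Hypothesis two0 : 2 = 0 :> R.
Hypothesis sqrtF : forall x : F, exists y, y ^+ 2 = x.

Lemma oppp (x : R) : - x = x.
Proof. char2_ring two0. Qed.

Lemma size_cancel_lead (p q : R) :
  p != 0 -> size q = size p -> lead_coef q = lead_coef p ->
  (size (p + q)%R < size p)%N.
Proof.
move=> p0 sq lq; rewrite -(oppp q) /=.
have [->|pq0] := eqVneq (p - q) 0; first by rewrite size_poly0 size_poly_gt0.
have spq : (size (p - q)%R <= size p)%N.
  by rewrite (leq_trans (size_polyD _ _)) // size_polyN sq maxnn.
rewrite ltn_neqAle spq andbT; apply/negP => /eqP e.
move: pq0; rewrite -lead_coef_eq0 lead_coefE e coefB.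
by rewrite -{2}sq -!lead_coefE lq subrr eqxx.
Qed.

(** A quotient of leading coefficients is a square, the field being perfect,
    and the parity condition makes the quotient of the leading terms a square.
    The size of k is recorded because k itself, and not only its square, is
    added to c in the descent below. *)
Lemma cancel_lead_square (e c : R) :
  e != 0 -> (size e <= size c)%N -> odd (size c) = odd (size e) ->
  exists k : R, size k = (size c - size e)./2.+1
             /\ (size (c + k ^+ 2 * e)%R < size c)%N.
Proof.
move=> e0 sec par; pose d := (size c - size e)./2.
have c0 : c != 0 by rewrite -size_poly_gt0 (leq_trans _ sec) // size_poly_gt0.
have le0 : lead_coef e != 0 by rewrite lead_coef_eq0.
have [mu Hmu] := sqrtF (lead_coef c / lead_coef e).
have mu0 : mu != 0.
  apply: contra_neq c0 => mu0; apply/eqP; rewrite -lead_coef_eq0.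
  by rewrite -(divfK le0 (lead_coef c)) -Hmu mu0 expr0n mul0r.
exists (mu *: 'X^d); rewrite size_scale // size_polyXn; split=> //.
apply: size_cancel_lead => //.
  rewrite exprZn -scalerAl size_scale ?expf_neq0 // -exprM mulrC size_mulXn //.
  by rewrite muln2 /d halfK oddB // par addbb subn0 subnK.
by rewrite exprZn -scalerAl lead_coefZ -exprM lead_coefM lead_coefXn mul1r Hmu divfK.
Qed.

(** The equations say that e x^2 + x y + c y^2 is the product of p x + q y and
    r x + s y plus the square of al x + be y.  Squares can be moved between the
    form and the last term, and x can be translated by a multiple of y: this
    allows a descent on the sizes of e and c, which stops when e or c is 0 and
    the form is visibly a product. *)
Lemma split_ternary (e c : R) :
  exists p q r s al be : R,
    [/\ p * s + q * r = 1, e = p * r + al ^+ 2 & c = q * s + be ^+ 2].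
Proof.
have [k] := ubnP (size e + size c); elim: k e c => // k IHk e c.
wlog sec : e c / (size e <= size c)%N.
  move=> W; have [/W //|/ltnW /W W' k_gt] := leqP (size e) (size c).
  have [|p [q [r [s [al [be [h1 h2 h3]]]]]]] := W'; first by rewrite addnC.
  by exists q, p, s, r, be, al; split => //; rewrite addrC.
rewrite ltnS => sk.
have [->|e0] := eqVneq e 0; first by exists 1, c, 0, 1, 0, 0; split; ring.
have c0 : c != 0 by rewrite -size_poly_gt0 (leq_trans _ sec) // size_poly_gt0.
(* An odd size means an even degree, and the leading term is a square. *)
have [oc|ec] := boolP (odd (size c)).
  have [||k0 [_ lt]] := @cancel_lead_square 1 c (oner_neq0 _).
  - by rewrite size_poly1 size_poly_gt0.
  - by rewrite size_poly1 oc.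
  have [|p [q [r [s [al [be [h1 h2 h3]]]]]]] := IHk e (c + k0 ^+ 2 * 1).
    by apply: leq_trans sk; rewrite ltn_add2l.
  exists p, q, r, s, al, (be + k0); split=> //.
  have -> : c = (c + k0 ^+ 2 * 1) + k0 ^+ 2 by char2_ring two0.
  by rewrite h3; char2_ring two0.
have [oe|ee] := boolP (odd (size e)).
  have [||k0 [_ lt]] := @cancel_lead_square 1 e (oner_neq0 _).
  - by rewrite size_poly1 size_poly_gt0.
  - by rewrite size_poly1 oe.
  have [|p [q [r [s [al [be [h1 h2 h3]]]]]]] := IHk (e + k0 ^+ 2 * 1) c.
    by apply: leq_trans sk; rewrite ltn_add2r.
  exists p, q, r, s, (al + k0), be; split=> //.
  have -> : e = (e + k0 ^+ 2 * 1) + k0 ^+ 2 by char2_ring two0.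
  by rewrite h2; char2_ring two0.
(* Both degrees are odd: translating x by k0 y replaces c by the polynomial
   c + k0^2 e + k0. *)
have [|k0 [sk0 lt]] := cancel_lead_square e0 sec; first by rewrite (negbTE ec) (negbTE ee).
have se2 : (1 < size e)%N.
  by move: ee e0; rewrite -size_poly_gt0; case: (size e) => [|[]].
have sk0' : (size k0 < size c)%N.
  rewrite sk0; lia.
have [|p [q [r [s [al [be [h1 h2 h3]]]]]]] := IHk e (c + k0 ^+ 2 * e + k0).
  apply: leq_trans sk; rewrite ltn_add2l.
  by rewrite (leq_ltn_trans (size_polyD _ _)) // gtn_max lt.
exists p, (q + p * k0), r, (s + r * k0), al, (be + al * k0); split=> //.
  by rewrite -h1; char2_ring two0.
have -> : c = (c + k0 ^+ 2 * e + k0) + k0 ^+ 2 * e + k0 * 1 by char2_ring two0.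
by rewrite h3 -h1 h2; char2_ring two0.
Qed.

(** The witness t is the part of b prime to p.  A prime factor of b that divides
    p divides neither t nor q; one that does not divide p divides t.  In both
    cases it does not divide p + q t^2. *)
Lemma coprime_shift (p q b : R) :
  b != 0 -> (forall d, d %| p -> d %| q -> d %| b -> d %= 1) ->
  exists t, coprimep (p + q * t ^+ 2) b.
Proof.
move=> b0 prim; exists (gdcop p b); set t := gdcop p b.
have tp : coprimep t p by apply: coprimep_gdco.
rewrite coprimep_def -dvdp1; set e := gcdp _ _.
have e1 : e %| p + q * t ^+ 2 by apply: dvdp_gcdl.
have eb : e %| b by apply: dvdp_gcdr.
have et : coprimep e t.
  rewrite coprimep_def -dvdp1.
  apply: (dvdp_trans _ (_ : gcdp t p %| 1)); last by rewrite dvdp1 -coprimep_def.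
  rewrite dvdp_gcd dvdp_gcdr /=.
  have -> : p = (p + q * t ^+ 2) - t * (q * t) by ring.
  rewrite dvdp_sub //; first exact: dvdp_trans (dvdp_gcdl _ _) e1.
  exact: dvdp_mulr (dvdp_gcdr _ _).
have ep : coprimep e p.
  rewrite -gcdp_eqp1; apply: prim; first exact: dvdp_gcdr; last first.
    exact: dvdp_trans (dvdp_gcdl _ _) eb.
  have gt : coprimep (gcdp e p) (t ^+ 2).
    by apply: coprimep_expr; apply: coprimep_dvdr (dvdp_gcdl _ _) et.
  rewrite -(Gauss_dvdpl _ gt).
  have -> : q * t ^+ 2 = (p + q * t ^+ 2) - p by ring.
  by rewrite dvdp_sub ?dvdp_gcdr // (dvdp_trans (dvdp_gcdl _ _)).
have : e %| t * p ^+ size b.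
  apply: dvdp_trans eb _; have [p0|p0] := eqVneq p 0; last exact: dvdp_gdcor.
  by rewrite p0 expr0n size_poly_eq0 (negbTE b0) mulr0 dvdp0.
rewrite (Gauss_dvdpr _ et) => h.
have := coprimep_expr (size b) ep; rewrite -gcdp_eqp1 => h2.
by rewrite -(eqp_dvdr _ h2) dvdp_gcd dvdpp.
Qed.
End SplitTernary.

(** * The subgroup R_b *)

Section IndexTwo.
Variables (n : nat) (F : finFieldType) (cardF : #|F| = (2 ^ n)%N).
Variables (G : {set F}) (subG : GRing.zmod_closed G).
Hypotheses (cardG : #|G| = (2 ^ n.-1)%N) (notin1 : 1 \notin G).
Variable b : {poly F}.
Hypothesis b_neq0 : b != 0.

(** G and its translate by 1 are disjoint, and together they have as many
    elements as the field. *)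
Lemma index2_dichotomy (x : F) : x \in G \/ x + 1 \in G.
Proof.
have [G0 GB] := subG.
have inj : injective (fun y : F => y + 1) by apply: addIr.
have disj : [disjoint G & [set y + 1 | y in G]].
  rewrite -finset.setI_eq0; apply/eqP/setP => y; rewrite !inE; apply/negP.
  case/andP => yG /imsetP[z zG yz]; move/negP: notin1; apply.
  by rewrite -(addKr z 1) -yz addrC GB.
have : x \in G :|: [set y + 1 | y in G].
  suff -> : G :|: [set y + 1 | y in G] = [set: F] by rewrite inE.
  apply/eqP; rewrite eqEcard finset.subsetT cardsT cardF /=.
  move: disj; rewrite -leq_card_setU => /eqP ->.
  rewrite card_imset // cardG addnn -muln2 -expnSr prednK //.
  exact: char2_log_gt0 cardF.
case/setUP => [|/imsetP[y yG ->]]; [by left | right].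
have := char2_two0 cardF; rewrite -[2]/(1 + 1) => e.
by rewrite -addrA e addr0.
Qed.

Lemma Rb0 : Rb G b 0.
Proof.
exists 0, 0; split; rewrite ?mul0r ?addr0 ?size_poly0 ?size_poly_gt0 //.
by rewrite horner0; case: subG.
Qed.

Lemma RbD (k l : {poly F}) : Rb G b k -> Rb G b l -> Rb G b (k + l).
Proof.
have [G0 GB] := subG.
move=> [q [r [-> sr qG]]] [q' [r' [-> sr' q'G]]].
exists (q + q'), (r + r'); split; first by ring.
  by rewrite (leq_ltn_trans (size_polyD _ _)) // gtn_max sr.
by rewrite hornerD -[q'.[0]]opprK GB // -[- _]sub0r GB.
Qed.

Lemma Rb_dichotomy (k : {poly F}) : Rb G b k \/ Rb G b (k + b).
Proof.
case: (index2_dichotomy (k %/ b).[0]) => h; [left | right].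
  by exists (k %/ b), (k %% b); rewrite -divp_eq ltn_modp.
exists (k %/ b + 1), (k %% b); rewrite ltn_modp hornerD hornerC; split=> //.
by rewrite mulrDl mul1r addrAC -divp_eq.
Qed.

(** The quotient of b by itself is 1, which is not in G. *)
Lemma notin_Rb : ~ Rb G b b.
Proof.
move=> [q [r [e sr qG]]].
have e2 : (1 - q) * b = r by rewrite mulrBl mul1r {1}e addrC addKr.
have q1 : 1 - q = 0.
  apply: contraTeq sr => nz; rewrite -leqNgt -e2 mulrC size_mul //.
  by rewrite -subn1 -addnBA ?leq_addr // size_poly_gt0.
move/negP: notin1; apply; move: qG.
by rewrite -(subr0_eq q1) hornerC.
Qed.

(** Two elements with the same image under phi are equal or differ by b. *)
Lemma Rb_eq (two0 : 2 = 0 :> {poly F}) (k l : {poly F}) :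
  Rb G b k -> Rb G b l -> k ^+ 2 + b * k = l ^+ 2 + b * l -> k = l.
Proof.
move=> Rk Rl e; have : (k - l) * (k + l + b) = 0.
  transitivity (k ^+ 2 + b * k - (l ^+ 2 + b * l)); first by ring.
  by rewrite e subrr.
move/eqP; rewrite mulf_eq0 => /orP[/eqP/subr0_eq //|/eqP klb].
case: notin_Rb; have e' : b = k + l.
  by have -> : b = (k + l + b) + (k + l) by [char2_ring two0]; rewrite klb add0r.
by rewrite {2}e'; apply: RbD.
Qed.

End IndexTwo.

(** * Forms and proper equivalence *)

Section FormsChar2.
Variable F : finFieldType.
Local Notation R := {poly F}.
Hypothesis two0 : 2 = 0 :> R.
Implicit Types (f g h : bqf R).

Definition value f (x y : R) : R := bqf_eval (qa f) (qb f) (qc f) x y.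

(** The polynomial whose membership in R_b makes an equivalence proper.  If a
    root t of t^2 + b t + Delta = a c orients the form, then the substitution
    adds the twist to t. *)
Definition twist f (p q r s : R) : R :=
  qa f * p * r + qb f * q * r + qc f * q * s.

Definition transform f (p q r s : R) : bqf R :=
  Bqf (value f p q) (qb f) (value f r s).

Lemma value_transform f p q r s x y : p * s + q * r = 1 ->
  value (transform f p q r s) x y = value f (x * p + y * r) (x * q + y * s).
Proof.
move=> det1; transitivity (value f p q * x ^+ 2
    + qb f * (p * s + q * r) * x * y + value f r s * y ^+ 2).
  by rewrite det1 mulr1.
by rewrite /value /bqf_eval; char2_ring two0.
Qed.

Lemma transform_comp f p q r s p' q' r' s' : p * s + q * r = 1 ->
  transform (transform f p q r s) p' q' r' s' =
  transform f (p' * p + q' * r) (p' * q + q' * s)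
              (r' * p + s' * r) (r' * q + s' * s).
Proof. by move=> det1; rewrite {1}/transform !value_transform. Qed.

(** The twist is a cocycle, which is why proper equivalence is transitive. *)
Lemma twist_comp f p q r s p' q' r' s' :
  p * s + q * r = 1 -> p' * s' + q' * r' = 1 ->
  twist f (p' * p + q' * r) (p' * q + q' * s)
          (r' * p + s' * r) (r' * q + s' * s)
  = twist f p q r s + twist (transform f p q r s) p' q' r' s'.
Proof.
move=> det1 det1'.
transitivity (p' * r' * value f p q + q' * s' * value f r s
    + q' * r' * (qb f * (p * s + q * r))
    + (p' * s' + q' * r') * twist f p q r s).
  by rewrite /twist /value /bqf_eval; char2_ring two0.
by rewrite det1 det1' /twist /transform /=; ring.
Qed.

Lemma transform1 f : transform f 1 0 0 1 = f.
Proof. by case: f => a b c; rewrite /transform /value /bqf_eval; congr Bqf => /=; ring. Qed.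

Lemma twist1 f : twist f 1 0 0 1 = 0.
Proof. by rewrite /twist; ring. Qed.

(** Why the class of a c modulo the image of phi is an invariant. *)
Lemma transform_disc f p q r s : p * s + q * r = 1 ->
  value f p q * value f r s
  = qa f * qc f + phi (qb f) (twist f p q r s).
Proof.
move=> det1.
transitivity ((p * s + q * r) ^+ 2 * (qa f * qc f) +
  twist f p q r s ^+ 2 + qb f * (p * s + q * r) * twist f p q r s); last first.
  by rewrite det1 /phi; ring.
by rewrite /twist /value /bqf_eval; char2_ring two0.
Qed.

Definition mx2 (p q r s : R) : 'M[R]_2 :=
  \matrix_(i, j) if i == 0 then if j == 0 then p else q
                 else if j == 0 then r else s.

Lemma det2 (u : 'M[R]_2) : \det u = u 0 0 * u 1 1 + u 0 1 * u 1 0.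
Proof.
rewrite (expand_det_row _ 0) !big_ord_recl big_ord0 /cofactor !det_mx11 !mxE /=.
rewrite addr0 expr0 expr1.
have -> : lift 0 0 = 1 :> 'I_2 by apply/val_inj.
have -> : lift 1 0 = 0 :> 'I_2 by apply/val_inj.
char2_ring two0.
Qed.

Lemma proper_equivP G f g : proper_equiv G f g <->
  exists p q r s, [/\ p * s + q * r = 1, g = transform f p q r s
                    & Rb G (qb f) (twist f p q r s)].
Proof.
split=> [[u [du ug uR]]|[p [q [r [s [det1 -> tR]]]]]].
  by exists (u 0 0), (u 0 1), (u 1 0), (u 1 1); rewrite -det2.
by exists (mx2 p q r s); rewrite det2 /bqf_act /twist !mxE.
Qed.

Lemma poly_unit_eqp1 (d : R) : (d \is a GRing.unit) = (d %= 1).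
Proof.
rewrite poly_unitE -size_poly_eq1; case: eqP => //= s1.
have -> : d`_0 = lead_coef d by rewrite lead_coefE s1.
by rewrite unitfE lead_coef_eq0 -size_poly_eq0 s1.
Qed.

Lemma bezout_gcdp (p q : R) : exists u v, u * p + v * q = gcdp p q.
Proof.
have [[u v] /= /eqpP[[c1 c2] /= /andP[c10 c20] h]] := Bezoutp p q.
exists (c2^-1 *: (c1 *: u)), (c2^-1 *: (c1 *: v)).
by rewrite -!scalerAl -!scalerDr h scalerA mulVf // scale1r.
Qed.

Lemma primitive_bezout f : primitive f ->
  exists u v w, u * qa f + v * qb f + w * qc f = 1.
Proof.
move=> prim.
have [u [v uv]] := bezout_gcdp (qa f) (qb f).
have /Bezout_eq1_coprimepP[[s t] /= st] : coprimep (gcdp (qa f) (qb f)) (qc f).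
  rewrite coprimep_def size_poly_eq1 -poly_unit_eqp1; apply: prim.
  - exact: dvdp_trans (dvdp_gcdl _ _) (dvdp_gcdl _ _).
  - exact: dvdp_trans (dvdp_gcdl _ _) (dvdp_gcdr _ _).
  - exact: dvdp_gcdr.
by exists (s * u), (s * v), t; rewrite -st -uv; ring.
Qed.

Lemma bezout_primitive f u v w :
  u * qa f + v * qb f + w * qc f = 1 -> primitive f.
Proof.
move=> e d da db dc; rewrite poly_unit_eqp1 -size_poly_eq1 -dvdp1 -e.
by rewrite !dvdp_add // dvdp_mull.
Qed.

Lemma dvdp_value (d : R) f x y :
  d %| qa f -> d %| qb f -> d %| qc f -> d %| value f x y.
Proof.
move=> da db dc; rewrite /value /bqf_eval.
by rewrite !dvdp_add // -?mulrA dvdp_mulr.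
Qed.

Section ProperEquivalence.
Variables (G : {set F}) (subG : GRing.zmod_closed G).

Lemma proper_equiv_refl f : qb f != 0 -> proper_equiv G f f.
Proof.
move=> b0; apply/proper_equivP; exists 1, 0, 0, 1.
by rewrite transform1 twist1; split=> //; [ring | exact: Rb0].
Qed.

Lemma proper_equiv_qb f g : proper_equiv G f g -> qb g = qb f.
Proof. by case/proper_equivP=> [p [q [r [s [_ -> _]]]]]. Qed.

(** In characteristic 2 the inverse of (p, q; r, s) is (s, q; r, p), and by the
    cocycle relation its twist is that of the matrix itself. *)
Lemma proper_equiv_sym f g : proper_equiv G f g -> proper_equiv G g f.
Proof.
case/proper_equivP=> [p [q [r [s [det1 -> Rt]]]]]; apply/proper_equivP.
have det1' : s * p + q * r = 1 by rewrite mulrC.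
exists s, q, r, p; split=> //.
  rewrite transform_comp //.
  have -> : s * p + q * r = 1 by [].
  have -> : s * q + q * s = 0 by char2_ring two0.
  have -> : r * p + p * r = 0 by char2_ring two0.
  by rewrite [r * q]mulrC [q * r + _]addrC det1 transform1.
suff -> : twist (transform f p q r s) s q r p = twist f p q r s by [].
apply: subr0_eq; rewrite (oppp two0) addrC -twist_comp // det1'.
have -> : s * q + q * s = 0 by char2_ring two0.
have -> : r * p + p * r = 0 by char2_ring two0.
by rewrite [r * q]mulrC [q * r + _]addrC det1 twist1.
Qed.

Lemma proper_equiv_trans f g h : qb f != 0 ->
  proper_equiv G f g -> proper_equiv G g h -> proper_equiv G f h.
Proof.
move=> b0 /proper_equivP[p [q [r [s [det1 -> Rt]]]]].
case/proper_equivP=> [p' [q' [r' [s' [det1' -> Rt']]]]]; apply/proper_equivP.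
exists (p' * p + q' * r), (p' * q + q' * s), (r' * p + s' * r), (r' * q + s' * s).
split; last by rewrite (twist_comp f det1 det1'); apply: RbD.
  transitivity ((p' * s' + q' * r') * (p * s + q * r)); last first.
    by rewrite det1 det1' mul1r.
  by char2_ring two0.
by rewrite transform_comp.
Qed.

Lemma proper_equiv_value f g : proper_equiv G f g ->
  forall x y, exists x' y', value g x y = value f x' y'.
Proof.
case/proper_equivP=> [p [q [r [s [det1 -> _]]]]] x y.
by rewrite value_transform //; do 2!eexists.
Qed.

Lemma proper_equiv_primitive f g :
  proper_equiv G f g -> primitive f -> primitive g.
Proof.
move=> /proper_equiv_sym /proper_equivP[p [q [r [s [_ -> _]]]]] prim d da db dc.
by apply: prim => //; apply: dvdp_value.
Qed.

Lemma proper_equiv_disc f g : proper_equiv G f g ->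
  exists t, qa g * qc g = qa f * qc f + phi (qb f) t.
Proof.
case/proper_equivP=> [p [q [r [s [det1 -> _]]]]].
by exists (twist f p q r s); apply: transform_disc.
Qed.

Lemma class_of_eq f g : qb f != 0 ->
  proper_equiv G f g -> class_of G f = class_of G g.
Proof.
move=> b0 fg; have gf := proper_equiv_sym fg.
apply/predeqP => h; split=> -[prim eh]; split=> //.
  by apply: proper_equiv_trans gf eh; rewrite (proper_equiv_qb fg).
exact: proper_equiv_trans fg eh.
Qed.

End ProperEquivalence.
End FormsChar2.

(** * Direct composition in terms of a 2 x 4 matrix *)

Section Composition.
Variable F : finFieldType.
Local Notation R := {poly F}.
Hypothesis two0 : 2 = 0 :> R.
Variables (G : {set F}) (subG : GRing.zmod_closed G).
Implicit Types (f g : bqf R) (p q r s k : R * R).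

Definition minor p q : R := p.1 * q.2 + p.2 * q.1.

(** The three quadratic forms of a 2 x 2 x 2 cube (Bhargava), read in
    characteristic 2; p, q, r, s are the columns of the matrix of the bilinear
    forms L_1 and L_2. *)
Definition cube p q r s : bqf R * bqf R * bqf R :=
  let b := minor p s + minor q r in
  (Bqf (minor p q) b (minor r s), Bqf (minor p r) b (minor q s),
   Bqf (q.2 * r.2 + p.2 * s.2) b (q.1 * r.1 + p.1 * s.1)).

(** The first condition orients the composition with respect to f1 and f2, the
    second with respect to f1 and f3. *)
Definition composes f1 f2 f3 : Prop :=
  exists p q r s, [/\ (f1, f2, f3) = cube p q r s,
    Rb G (qb f3) (minor q r) & Rb G (qb f3) (p.2 * s.1 + q.2 * r.1)].

Lemma composes_qb f1 f2 f3 : composes f1 f2 f3 -> qb f1 = qb f3 /\ qb f2 = qb f3.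
Proof. by case=> [p [q [r [s [[-> -> ->] _ _]]]]]. Qed.

Lemma cube_identity (S : comNzRingType) (two0S : 2 = 0 :> S)
    (p1 q1 r1 s1 p2 q2 r2 s2 x y z w : S) :
  let b := p1 * s2 + p2 * s1 + (q1 * r2 + q2 * r1) in
  bqf_eval (p1 * q2 + p2 * q1) b (r1 * s2 + r2 * s1) x y *
  bqf_eval (p1 * r2 + p2 * r1) b (q1 * s2 + q2 * s1) z w =
  bqf_eval (q2 * r2 + p2 * s2) b (q1 * r1 + p1 * s1)
    (p1 * x * z + q1 * x * w + r1 * y * z + s1 * y * w)
    (p2 * x * z + q2 * x * w + r2 * y * z + s2 * y * w).
Proof. by rewrite /bqf_eval /=; char2_ring two0S. Qed.

(** Polarizing the identity in one of the pairs of variables gives b times a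
    coefficient of f1 or f2 on the left, and b times a minor on the right.
    This yields f1, f2 and b; then f3 follows from its values at the columns
    p and q, which are independent since their minor is the coefficient a of
    f1. *)
Lemma cube_of_identity f1 f2 f3 p q r s :
    qa f1 != 0 -> qb f3 != 0 -> qb f1 = qb f3 -> qb f2 = qb f3 ->
    (forall x y z w, value f1 x y * value f2 z w =
      value f3 (p.1 * x * z + q.1 * x * w + r.1 * y * z + s.1 * y * w)
               (p.2 * x * z + q.2 * x * w + r.2 * y * z + s.2 * y * w)) ->
  (f1, f2, f3) = cube p q r s.
Proof.
move: f1 f2 f3 => [a1 b1 c1] [a2 b2 c2] [a3 b c3] /= a1_0 b0 -> ->.
rewrite /value /= => E.
case: p q r s E => [p1 p2] [q1 q2] [r1 r2] [s1 s2] /= E.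
pose L x y z w := bqf_eval a1 b c1 x y * bqf_eval a2 b c2 z w.
have Epp : a1 * a2 = bqf_eval a3 b c3 p1 p2.
  by apply: (etrans _ (etrans (E 1 0 1 0) _)); rewrite /bqf_eval; ring.
have Eqq : a1 * c2 = bqf_eval a3 b c3 q1 q2.
  by apply: (etrans _ (etrans (E 1 0 0 1) _)); rewrite /bqf_eval; ring.
have Epq : a1 = p1 * q2 + p2 * q1.
  apply: (mulfI b0); transitivity (L 1 0 1 1 + L 1 0 1 0 + L 1 0 0 1).
    by rewrite /L /bqf_eval; char2_ring two0.
  by rewrite /L !E /bqf_eval; char2_ring two0.
have Epr : a2 = p1 * r2 + p2 * r1.
  apply: (mulfI b0); transitivity (L 1 1 1 0 + L 1 0 1 0 + L 0 1 1 0).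
    by rewrite /L /bqf_eval; char2_ring two0.
  by rewrite /L !E /bqf_eval; char2_ring two0.
have Eqs : c2 = q1 * s2 + q2 * s1.
  apply: (mulfI b0); transitivity (L 1 1 0 1 + L 1 0 0 1 + L 0 1 0 1).
    by rewrite /L /bqf_eval; char2_ring two0.
  by rewrite /L !E /bqf_eval; char2_ring two0.
have Ers : c1 = r1 * s2 + r2 * s1.
  apply: (mulfI b0); transitivity (L 0 1 1 1 + L 0 1 1 0 + L 0 1 0 1).
    by rewrite /L /bqf_eval; char2_ring two0.
  by rewrite /L !E /bqf_eval; char2_ring two0.
have Eb : b = p1 * s2 + p2 * s1 + (q1 * r2 + q2 * r1).
  apply: (mulfI b0).
  transitivity (L 1 1 1 1 + L 1 0 1 0 + L 1 0 0 1 + L 0 1 1 0 + L 0 1 0 1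
                + b * a1 + b * c1 + b * a2 + b * c2).
    by rewrite /L /bqf_eval; char2_ring two0.
  by rewrite Epq Ers Epr Eqs /L !E /bqf_eval; char2_ring two0.
(* The combination of the values at p and q that eliminates c3. *)
have Ea3 : a3 = q2 * r2 + p2 * s2.
  apply: (mulfI (mulf_neq0 a1_0 a1_0)).
  transitivity (bqf_eval a3 b c3 p1 p2 * q2 ^+ 2
    + bqf_eval a3 b c3 q1 q2 * p2 ^+ 2 + b * p2 * q2 * a1).
    by rewrite Epq /bqf_eval; char2_ring two0.
  by rewrite -Epp -Eqq Eb Epr Eqs Epq; char2_ring two0.
(* The combination of the values at p and q that eliminates a3. *)
have Ec3 : c3 = q1 * r1 + p1 * s1.
  apply: (mulfI (mulf_neq0 a1_0 a1_0)).
  transitivity (bqf_eval a3 b c3 p1 p2 * q1 ^+ 2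
    + bqf_eval a3 b c3 q1 q2 * p1 ^+ 2 + b * p1 * q1 * a1).
    by rewrite Epq /bqf_eval; char2_ring two0.
  by rewrite -Epp -Eqq Eb Epr Eqs Epq; char2_ring two0.
by rewrite /cube /minor /= -Epq -Epr -Eqs -Ers -Eb -Ea3 -Ec3.
Qed.

Lemma direct_compositionP f1 f2 f3 : qa f1 != 0 -> qb f1 != 0 ->
  direct_composition G f1 f2 f3 <-> composes f1 f2 f3.
Proof.
move=> a1_0 b1_0; split; last first.
  move=> [[p1 p2] [[q1 q2] [[r1 r2] [[s1 s2] [[-> -> ->] Rk Rs]]]]].
  split=> //; split=> //.
  exists p1, q1, r1, s1, p2, q2, r2, s2; cbv zeta; split=> //.
  have two0' : 2 = 0 :> {mpoly {poly F}[4]} by rewrite -mpolyC_nat two0 mpolyC0.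
  rewrite /minor /= !rmorphD !rmorphM /=; exact: cube_identity.
move=> [b13 [b23 [p1 [q1 [r1 [s1 [p2 [q2 [r2 [s2 H]]]]]]]]]].
have [E Rk Rs] := H.
exists (p1, p2), (q1, q2), (r1, r2), (s1, s2); split=> //.
apply: cube_of_identity => //; first by rewrite -b13.
move=> x y z w /=; pose v (i : 'I_4) := [tuple x; y; z; w]`_i.
have v0 : v (inord 0) = x by rewrite /v inordK.
have v1 : v (inord 1) = y by rewrite /v inordK.
have v2 : v (inord 2) = z by rewrite /v inordK.
have v3 : v (inord 3) = w by rewrite /v inordK.
move: (congr1 (meval v) E); rewrite /bqf_eval /value /bqf_eval b13 b23 !expr2.
by rewrite !(mevalD, mevalM, mevalC, mevalXU) v0 v1 v2 v3.
Qed.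
End Composition.

(** * Composition of classes *)

Section CompositionClasses.
Variable F : finFieldType.
Local Notation R := {poly F}.
Hypothesis two0 : 2 = 0 :> R.
Variables (G : {set F}) (subG : GRing.zmod_closed G) (notin1 : 1 \notin G).
Implicit Types (f g : bqf R) (p q r s k : R * R).

Lemma composesC f1 f2 f3 : composes G f1 f2 f3 -> composes G f2 f1 f3.
Proof.
case=> [p [q [r [s [[-> -> ->] Rk Rs]]]]].
have qr : minor r q = minor q r by rewrite /minor; ring.
exists p, r, q, s; split.
- by rewrite /cube; congr (_, _, _); congr Bqf; rewrite /minor; ring.
- by rewrite qr.
have -> : p.2 * s.1 + r.2 * q.1 = (p.2 * s.1 + q.2 * r.1) + minor q r.
  by rewrite /minor; char2_ring two0.
exact: RbD.
Qed.

(** A change of the variables of f1 acts on the pairs of columns (p, r) and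
    (q, s).  Both conditions on R_b are kept, because both polynomials change by
    the twist. *)
Lemma composes_equivl f1 f1' f2 f3 :
  proper_equiv G f1 f1' -> composes G f1 f2 f3 -> composes G f1' f2 f3.
Proof.
case/(proper_equivP two0)=> [al [be [ga [de [det1 -> Rt]]]]].
case=> [[p1 p2] [[q1 q2] [[r1 r2] [[s1 s2] [e Rk Rs]]]]].
case: e Rk Rs Rt => -> -> ->; rewrite /= => Rk Rs Rt.
exists (al * p1 + be * r1, al * p2 + be * r2),
       (al * q1 + be * s1, al * q2 + be * s2),
       (ga * p1 + de * r1, ga * p2 + de * r2),
       (ga * q1 + de * s1, ga * q2 + de * s2).
set tw := twist _ _ _ _ _ in Rt.
(* Identities that hold for determinant 1 become homogeneous once the side of
   lower degree is multiplied by the determinant. *)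
have by_det x y : x * (al * de + be * ga) = y -> x = y.
  by rewrite det1 mulr1.
have b' : minor (al * p1 + be * r1, al * p2 + be * r2)
                (ga * q1 + de * s1, ga * q2 + de * s2)
        + minor (al * q1 + be * s1, al * q2 + be * s2)
                (ga * p1 + de * r1, ga * p2 + de * r2)
        = minor (p1, p2) (s1, s2) + minor (q1, q2) (r1, r2).
  by symmetry; apply: by_det; rewrite /minor /=; char2_ring two0.
split.
- rewrite /cube b' /transform /value /bqf_eval.
  congr (_, _, _); congr Bqf; rewrite /minor /=; try by char2_ring two0.
  + by apply: by_det; char2_ring two0.
  + by apply: by_det; char2_ring two0.
  + by apply: by_det; char2_ring two0.
  + by apply: by_det; char2_ring two0.
- have -> : minor (al * q1 + be * s1, al * q2 + be * s2)
                  (ga * p1 + de * r1, ga * p2 + de * r2)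
          = minor (q1, q2) (r1, r2) + tw.
    have -> : minor (q1, q2) (r1, r2)
        = minor (q1, q2) (r1, r2) * (al * de + be * ga) by rewrite det1 mulr1.
    by rewrite /tw /minor /twist /=; char2_ring two0.
  exact: RbD.
rewrite /=.
have -> : (al * p2 + be * r2) * (ga * q1 + de * s1)
        + (al * q2 + be * s2) * (ga * p1 + de * r1)
        = (p2 * s1 + q2 * r1) + tw.
  have -> : p2 * s1 + q2 * r1 = (p2 * s1 + q2 * r1) * (al * de + be * ga).
    by rewrite det1 mulr1.
  by rewrite /tw /minor /twist /=; char2_ring two0.
exact: RbD.
Qed.

Lemma composes_equiv f1 f1' f2 f2' f3 :
  proper_equiv G f1 f1' -> proper_equiv G f2 f2' ->
  composes G f1 f2 f3 -> composes G f1' f2' f3.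
Proof.
move=> e1 e2 c; apply: composesC; apply: (composes_equivl e2); apply: composesC.
exact: composes_equivl e1 c.
Qed.

(** Two unimodular matrices with the same minors differ by an element of SL_2.
    For columns i and j, the product of the submatrix (i, j) of the first
    matrix and the adjugate of that of the second is the minor of i and j times
    the required element, by Cramer's rule; a Bezout relation between the minors
    combines these products into the element itself. *)
Lemma columns_of_minors p q r s p' q' r' s' (u v w : R) :
    let agree k k' := [/\ minor p k = minor p' k', minor q k = minor q' k',
                           minor r k = minor r' k' & minor s k = minor s' k'] in
    [/\ agree p p', agree q q', agree r r' & agree s s'] ->
    u * minor p q + v * (minor p s + minor q r) + w * minor r s = 1 ->
  exists a b c d : R, a * d + b * c = 1 /\
    let act (k' : R * R) := (a * k'.1 + b * k'.2, c * k'.1 + d * k'.2) in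
    [/\ p = act p', q = act q', r = act r' & s = act s'].
Proof.
move=> agree [Ap Aq Ar As] bez.
pose e11 (x y x' y' : R * R) : R := x.1 * y'.2 + y.1 * x'.2.
pose e12 (x y x' y' : R * R) : R := x.1 * y'.1 + y.1 * x'.1.
pose e21 (x y x' y' : R * R) : R := x.2 * y'.2 + y.2 * x'.2.
pose e22 (x y x' y' : R * R) : R := x.2 * y'.1 + y.2 * x'.1.
pose comb (e : R * R -> R * R -> R * R -> R * R -> R) : R :=
  u * e p q p' q' + v * (e p s p' s' + e q r q' r') + w * e r s r' s'.
have actE k k' : agree k k' ->
  k = (comb e11 * k'.1 + comb e12 * k'.2, comb e21 * k'.1 + comb e22 * k'.2).
  move=> [hp hq hr hs].
  have key1 : comb e11 * k'.1 + comb e12 * k'.2 =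
    u * (p.1 * minor q' k' + q.1 * minor p' k') +
    v * (p.1 * minor s' k' + s.1 * minor p' k' + q.1 * minor r' k' + r.1 * minor q' k') +
    w * (r.1 * minor s' k' + s.1 * minor r' k').
    by rewrite /comb /e11 /e12 /minor; ring.
  have key2 : comb e21 * k'.1 + comb e22 * k'.2 =
    u * (p.2 * minor q' k' + q.2 * minor p' k') +
    v * (p.2 * minor s' k' + s.2 * minor p' k' + q.2 * minor r' k' + r.2 * minor q' k') +
    w * (r.2 * minor s' k' + s.2 * minor r' k').
    by rewrite /comb /e21 /e22 /minor; ring.
  rewrite {}key1 {}key2 -hp -hq -hr -hs [k in LHS]surjective_pairing.
  congr pair.
    transitivity ((u * minor p q + v * (minor p s + minor q r) + w * minor r s) * k.1).
      by rewrite bez mul1r.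
    by rewrite /minor; char2_ring two0.
  transitivity ((u * minor p q + v * (minor p s + minor q r) + w * minor r s) * k.2).
    by rewrite bez mul1r.
  by rewrite /minor; char2_ring two0.
have [Ep Eq Er Es] := And4 (actE _ _ Ap) (actE _ _ Aq) (actE _ _ Ar) (actE _ _ As).
exists (comb e11), (comb e12), (comb e21), (comb e22); split=> //.
move: (comb e11) (comb e12) (comb e21) (comb e22) Ep Eq Er Es => a b c d Ep Eq Er Es.
have bez' : u * minor p' q' + v * (minor p' s' + minor q' r') + w * minor r' s' = 1.
  by rewrite -bez; case: Aq => -> _ _ _; case: Ar => _ -> _ _; case: As => -> _ -> _.
transitivity ((a * d + b * c)
  * (u * minor p' q' + v * (minor p' s' + minor q' r') + w * minor r' s')).
  by rewrite bez' mulr1.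
apply: etrans bez; rewrite Ep Eq Er Es /minor /=; char2_ring two0.
Qed.

(** The minor of q and r is the only one that f1 and f2 leave undetermined.
    The Pluecker relation gives its image under phi, and R_b contains only one
    solution.  So the matrices of the two compositions have the same
    minors and differ by an element of SL_2, whose twist as a substitution in
    f3' is the difference of two elements of R_b. *)
Lemma composes_uniq f1 f2 f3 f3' : primitive f1 -> qb f1 != 0 ->
  composes G f1 f2 f3 -> composes G f1 f2 f3' -> proper_equiv G f3' f3.
Proof.
move=> prim b0 c c'.
have [b1 b2] := composes_qb c; have [b1' b2'] := composes_qb c'.
have [u [v [w bez]]] := primitive_bezout prim.
case: c c' => [p [q [r [s [e Rk Rs]]]]] [p' [q' [r' [s' [e' Rk' Rs']]]]].
rewrite -b1 -b1' in Rk Rs Rk' Rs'.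
case: (e) (e') => ef1 ef2 ef3 [ef1' ef2' ef3'].
have plucker (x y z t : R * R) :
    minor y z ^+ 2 + (minor x t + minor y z) * minor y z
    = minor x y * minor z t + minor x z * minor y t.
  by rewrite /minor; char2_ring two0.
have eb : qb f1 = minor p s + minor q r by rewrite ef1.
have eb' : qb f1 = minor p' s' + minor q' r' by rewrite ef1'.
have pq : minor p q = minor p' q' by move: (congr1 (@qa _) ef1'); rewrite ef1.
have rs : minor r s = minor r' s' by move: (congr1 (@qc _) ef1'); rewrite ef1.
have pr : minor p r = minor p' r' by move: (congr1 (@qa _) ef2'); rewrite ef2.
have qs : minor q s = minor q' s' by move: (congr1 (@qc _) ef2'); rewrite ef2.
have qr : minor q r = minor q' r'.
  by apply: (Rb_eq subG notin1 b0 two0) => //; rewrite {1}eb eb' !plucker pq rs pr qs.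
have ps : minor p s = minor p' s'.
  by apply: (addIr (minor q r)); rewrite -eb eb' qr.
have minorC (x y : R * R) : minor x y = minor y x by rewrite /minor; ring.
have minorxx (x : R * R) : minor x x = 0 by rewrite /minor; char2_ring two0.
have [||a [b [c [d [det1 [Ep Eq Er Es]]]]]] := @columns_of_minors p q r s p' q' r' s' u v w.
  by split; split; rewrite ?minorxx // minorC ?pq ?pr ?ps ?qr ?qs ?rs minorC.
  by rewrite -bez ef1.
apply/(proper_equivP two0); exists d, c, b, a.
have sg : p.2 * s.1 + q.2 * r.1
    = (p'.2 * s'.1 + q'.2 * r'.1) + twist f3' d c b a.
  rewrite ef3' /twist /=.
  transitivity ((a * d + b * c) * (p'.2 * s'.1 + q'.2 * r'.1)
    + ((q'.2 * r'.2 + p'.2 * s'.2) * d * b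
      + (minor p' s' + minor q' r') * c * b
      + (q'.1 * r'.1 + p'.1 * s'.1) * c * a)).
    by rewrite Ep Eq Er Es /minor /=; char2_ring two0.
  by rewrite det1 mul1r.
split.
- by rewrite -det1; ring.
- rewrite ef3 -eb ef3' /transform /value /bqf_eval /= -eb'.
  congr Bqf; rewrite eb' Ep Eq Er Es /minor /=; char2_ring two0.
have -> : twist f3' d c b a
    = (p'.2 * s'.1 + q'.2 * r'.1) + (p.2 * s.1 + q.2 * r.1).
  by rewrite sg; char2_ring two0.
by rewrite -b1'; apply: RbD.
Qed.

(** Dirichlet's composition of (m, b, m c) with itself: L_1 = x z + c y w and
    L_2 = m x w + m y z + b y w. *)
Lemma square_composes (b m c : R) : b != 0 ->
  composes G (Bqf m b (m * c)) (Bqf m b (m * c)) (Bqf (m ^+ 2) b c).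
Proof.
move=> b0; exists (1, 0), (0, m), (0, m), (c, b); split.
- by rewrite /cube /minor /=; congr (_, _, _); congr Bqf; ring.
- have -> : minor (0, m) (0, m) = 0 by rewrite /minor /=; ring.
  exact: Rb0.
- rewrite /= mul0r mulr0 addr0.
  exact: Rb0.
Qed.

(** The same composition with the variables of all three forms exchanged. *)
Lemma square_composes_swap (b m c : R) : b != 0 ->
  composes G (Bqf (m * c) b m) (Bqf (m * c) b m) (Bqf c b (m ^+ 2)).
Proof.
move=> b0; exists (b, c), (m, 0), (m, 0), (0, 1); split.
- by rewrite /cube /minor /=; congr (_, _, _); congr Bqf; ring.
- have -> : minor (m, 0) (m, 0) = 0 by rewrite /minor /=; char2_ring two0.
  exact: Rb0.
- rewrite /= mulr0 mul0r addr0.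
  exact: Rb0.
Qed.

End CompositionClasses.

(** * Forms with a prescribed value *)

Section Genus.
Variables (n : nat) (F : finFieldType) (cardF : #|F| = (2 ^ n)%N).
Variables (G : {set F}) (subG : GRing.zmod_closed G).
Hypotheses (cardG : #|G| = (2 ^ n.-1)%N) (notin1 : 1 \notin G).
Local Notation R := {poly F}.
Local Notation "f =~ g" := (proper_equiv G f g) (at level 70).
Implicit Types (f g : bqf R).
Let two0 : 2 = 0 :> R := char2_poly_two0 cardF.

(** Exchanging the rows of the substitution adds b to its twist, so one of the
    two orders gives a proper equivalence. *)
Lemma equiv_value_or_swap f x y r s : qb f != 0 -> x * s + y * r = 1 ->
  f =~ Bqf (value f x y) (qb f) (value f r s) \/
  f =~ Bqf (value f r s) (qb f) (value f x y).
Proof.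
move=> b0 det1.
case: (Rb_dichotomy cardF subG cardG notin1 b0 (twist f x y r s)) => Rt.
  by left; apply/(proper_equivP two0); exists x, y, r, s.
right; apply/(proper_equivP two0); exists r, s, x, y; split=> //.
  by rewrite -det1; ring.
have -> : twist f r s x y = twist f x y r s + qb f; last by [].
by rewrite -[qb f in RHS]mulr1 -det1 /twist; char2_ring two0.
Qed.

Lemma coprime_primitive (a b c : R) : coprimep a b ->
  primitive (Bqf a b c) /\ primitive (Bqf c b a).
Proof.
case/Bezout_eq1_coprimepP=> [[u v] /= e]; split.
  by apply: (@bezout_primitive _ _ u v 0); rewrite /= mul0r addr0.
by apply: (@bezout_primitive _ _ 0 v u); rewrite /= mul0r add0r addrC.
Qed.

Lemma square_value_equiv f m x y u v : qb f != 0 -> u * x + v * y = 1 ->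
    value f x y = m ^+ 2 -> coprimep m (qb f) ->
  exists g h, [/\ f =~ h, primitive g, qb g = qb f, composes G g g h
                & qa g * qc g = qa h * qc h].
Proof.
move=> b0 bez fm cop; set c := value f v u.
have [pr1 pr2] := coprime_primitive (m * c) cop.
have det1 : x * u + y * v = 1 by rewrite -bez; ring.
have [e|e] := equiv_value_or_swap b0 det1; rewrite fm -/c in e.
  exists (Bqf m (qb f) (m * c)), (Bqf (m ^+ 2) (qb f) c); split=> //=.
    exact: square_composes.
  by ring.
exists (Bqf (m * c) (qb f) m), (Bqf c (qb f) (m ^+ 2)); split=> //=.
  exact: square_composes_swap.
by ring.
Qed.

(** Modulo b the value at (1, t) is a + c t^2. *)
Lemma primitive_value_coprime f : qb f != 0 -> primitive f ->
  exists t, coprimep (value f 1 t) (qb f).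
Proof.
move=> b0 prim.
have [|t ct] := @coprime_shift _ (qa f) (qc f) (qb f) b0.
  by move=> d da dc db; rewrite -poly_unit_eqp1; apply: prim.
exists t; rewrite coprimep_sym.
have -> : value f 1 t = t * qb f + (qa f + qc f * t ^+ 2).
  by rewrite /value /bqf_eval; ring.
by rewrite coprimep_addl_mul coprimep_sym.
Qed.

(** If k is a value prime to b, a translation by a multiple of the first
    variable makes the last coefficient divisible by k, and the resulting form
    composes with itself explicitly. *)
Lemma square_composition f : qb f != 0 -> primitive f ->
  exists g h k x y, [/\ f =~ g, composes G g g h, primitive h,
    qa g * qc g = qa h * qc h & value h x y = k ^+ 2 /\ coprimep k (qb f)].
Proof.
move=> b0 prim; have [t cop] := primitive_value_coprime b0 prim.
set k := value f 1 t in cop.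
have /Bezout_eq1_coprimepP[[al be] /= bez] := cop.
(* The translation by j changes the last coefficient c to c + b j + k j^2, and
   be is an inverse of b modulo k. *)
pose c := value f 0 1; pose j := be * c; pose c' := al * c + j ^+ 2.
have fc : value f j (1 + j * t) = k * c'.
  transitivity (c + qb f * j + j ^+ 2 * k).
    by rewrite /k /c /value /bqf_eval; char2_ring two0.
  transitivity ((al * k + be * qb f) * c + qb f * j + j ^+ 2 * k).
    by rewrite bez mul1r.
  by rewrite /c' /j; char2_ring two0.
have det1 : 1 * (1 + j * t) + t * j = 1 by char2_ring two0.
have [pr1 pr2] := coprime_primitive c' (coprimep_expl 2 cop).
have [e|e] := equiv_value_or_swap b0 det1; rewrite fc -/k in e.
  exists (Bqf k (qb f) (k * c')), (Bqf (k ^+ 2) (qb f) c'), k, 1, 0.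
  split=> //=; [exact: square_composes | by ring |].
  by rewrite /value /bqf_eval /=; split=> //; ring.
exists (Bqf (k * c') (qb f) k), (Bqf c' (qb f) (k ^+ 2)), k, 0, 1.
split=> //=; [exact: square_composes_swap | by ring |].
by rewrite /value /bqf_eval /=; split=> //; ring.
Qed.

(** In coordinates that put (x, y) first, f is (h^2 + b^2 e, b, c).  At (X, b Y)
    its value is (h X)^2 + b^2 (e X^2 + X Y + c Y^2), and the splitting of the
    last form makes it a square when (X, Y) is chosen so that the two linear
    factors take the values 1 and t^2.  The free parameter t is used to
    make X, and with it the square root of the value, prime to b. *)
Lemma represents_square f h x y u v : qb f != 0 -> u * x + v * y = 1 ->
    qb f ^+ 2 %| value f x y - h ^+ 2 -> coprimep h (qb f) ->
  exists m x' y' u' v', [/\ u' * x' + v' * y' = 1, value f x' y' = m ^+ 2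
                          & coprimep m (qb f)].
Proof.
move=> b0 bez /dvdpP[e fe] cop; set c := value f v u; set b := qb f in b0 fe cop *.
have det1 : x * u + y * v = 1 by rewrite -bez; ring.
have [p [q [r [s [al [be [det2 Ee Ec]]]]]]] := split_ternary two0 (char2_sqrt cardF) e c.
have [|t ct] := @coprime_shift _ s q b b0.
  move=> d ds dq _; rewrite -size_poly_eq1 -dvdp1 -det2.
  by rewrite dvdp_add ?(dvdp_mull _ ds) ?(dvdp_mulr _ dq).
pose X := s + q * t ^+ 2; pose Y := r + p * t ^+ 2.
have /Bezout_eq1_coprimepP[[U V] /= UV] : coprimep X (b * Y).
  rewrite coprimepMr ct /=; apply/Bezout_eq1_coprimepP; exists (p, q) => /=.
  by rewrite -det2 /X /Y; char2_ring two0.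
pose m := h * X + b * (t + al * X + be * Y).
exists m, (X * x + b * Y * v), (X * y + b * Y * u), (U * u + V * y), (U * v + V * x).
split; last 1 first.
- rewrite coprimep_sym /m addrC mulrC coprimep_addl_mul coprimepMr.
  by rewrite coprimep_sym cop coprimep_sym.
- rewrite -UV -[X in _ = U * X + _]mulr1 -[X in _ = _ + V * X]mulr1 -det1.
  by char2_ring two0.
rewrite -value_transform // /transform -/c -/b.
have -> : value f x y = h ^+ 2 + e * b ^+ 2 by rewrite -fe; ring.
have key : e * X ^+ 2 + X * Y + c * Y ^+ 2 = (t + al * X + be * Y) ^+ 2.
  transitivity ((p * X + q * Y) * (r * X + s * Y) + (al * X + be * Y) ^+ 2).
    rewrite -[X in _ + X * Y + _]mulr1 -det2 Ee Ec; char2_ring two0.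
  have -> : p * X + q * Y = p * s + q * r by rewrite /X /Y; char2_ring two0.
  have -> : r * X + s * Y = (p * s + q * r) * t ^+ 2.
    by rewrite /X /Y; char2_ring two0.
  by rewrite det2; char2_ring two0.
rewrite /value /bqf_eval /=.
transitivity ((h * X) ^+ 2 + b ^+ 2 * (e * X ^+ 2 + X * Y + c * Y ^+ 2)).
  by ring.
by rewrite key /m; char2_ring two0.
Qed.

(** The greatest common divisor d of x and y is prime to b, so h can be taken
    as an inverse of d modulo b^2.  The point (0, 0) occurs only if b is
    constant, and then every point will do. *)
Lemma primitive_point f x y : qb f != 0 -> qb f ^+ 2 %| value f x y - 1 ->
  exists x' y' u v h, [/\ u * x' + v * y' = 1,
    qb f ^+ 2 %| value f x' y' - h ^+ 2 & coprimep h (qb f)].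
Proof.
move=> b0 dv; have [u [v uv]] := bezout_gcdp x y; set d := gcdp x y in uv.
have /dvdpP[x' Ex] : d %| x by apply: dvdp_gcdl.
have /dvdpP[y' Ey] : d %| y by apply: dvdp_gcdr.
have vE : value f x y = d ^+ 2 * value f x' y'.
  by rewrite /value /bqf_eval Ex Ey; ring.
have [d0|d0] := eqVneq d 0.
  exists 1, 0, 1, 0, 1; split; [by ring | | exact: coprime1p].
  move: dv; rewrite vE d0 expr0n mul0r sub0r dvdpNr => b1.
  exact: dvdp_trans b1 (dvd1p _).
have [w Ew] := dvdpP _ _ dv.
have : coprimep d (qb f ^+ 2).
  apply/Bezout_eq1_coprimepP; exists (d * value f x' y', - w) => /=.
  by rewrite mulNr -Ew vE; ring.
case/Bezout_eq1_coprimepP=> [[h l] /= hl].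
exists x', y', u, v, h; split.
- apply: (mulfI d0); rewrite mulr1 -[RHS]uv Ex Ey; ring.
- have -> : value f x' y' - h ^+ 2 =
    l * (1 + h * d) * value f x' y' * qb f ^+ 2 + h ^+ 2 * (value f x y - 1).
    have -> : l * (1 + h * d) * value f x' y' * qb f ^+ 2
      = (h * d + l * qb f ^+ 2 - h * d) * (1 + h * d) * value f x' y' by ring.
    by rewrite hl vE; ring.
  by rewrite dvdp_add ?(dvdp_mull _ dv) ?(dvdp_mull _ (dvdpp _)).
by apply/Bezout_eq1_coprimepP; exists (d, l * qb f); rewrite -hl /=; ring.
Qed.

(** * Squares and the kernel *)

Section Discriminant.
Variables (b Delta : R) (b_neq0 : b != 0).

Definition has_disc f := qb f = b /\ exists t, qa f * qc f - Delta = phi b t.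

Lemma has_disc_mulE f g :
  has_disc f -> qb g = b -> qa f * qc f = qa g * qc g -> has_disc g.
Proof. by move=> [_ [t Et]] bg e; split=> //; exists t; rewrite -e. Qed.

Lemma has_disc_equiv f g : has_disc f -> f =~ g -> has_disc g.
Proof.
move=> [bf [t Et]] e; have [t' Et'] := proper_equiv_disc two0 e.
split; first by rewrite (proper_equiv_qb two0 e).
exists (t + t'); rewrite Et' bf.
have -> : qa f * qc f = Delta + phi b t by rewrite -Et; ring.
by rewrite /phi; char2_ring two0.
Qed.

Lemma has_disc_qa_neq0 f :
  ~ (exists t, Delta = phi b t) -> has_disc f -> qa f != 0.
Proof.
move=> nphi [_ [t Et]]; apply/eqP => a0; apply: nphi; exists t.
by rewrite -Et a0 mul0r sub0r (oppp two0).
Qed.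

Lemma class_mul_self f h : ~ (exists t, Delta = phi b t) ->
    has_disc f -> primitive f -> composes G f f h ->
  class_mul G (class_of G f) (class_of G f) = class_of G h.
Proof.
move=> nphi df prim c; have [bf _] := df.
have bf0 : qb f != 0 by rewrite bf.
have ff : f =~ f := proper_equiv_refl two0 subG bf0.
apply/predeqP => g; split.
  case=> f1 [f2 [h' [[_ e1] [_ e2] dc [prg eg]]]]; split=> //.
  have d1 := has_disc_equiv df e1.
  have b1 : qb f1 != 0 by case: d1 => ->.
  have /(direct_compositionP two0 _ _ _ (has_disc_qa_neq0 nphi d1) b1) c1 := dc.
  have c2 : composes G f f h'.
    by apply: (composes_equiv two0 subG _ _ c1); apply: (proper_equiv_sym two0).
  have hh' : h =~ h'.
    exact: (composes_uniq two0 subG notin1 prim bf0 c2 c).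
  apply: (proper_equiv_trans two0 subG _ hh' eg).
  by have [<- _] := composes_qb c.
move=> hg; exists f, f, h; split=> //.
by apply/(direct_compositionP two0 _ _ _ (has_disc_qa_neq0 nphi df) bf0).
Qed.

(** Let u and v be the elements of the ideal (a, theta + t) attached to g with
    coordinates (x0, y0) and (x, y).  The product of u with the conjugate of v
    is a times an element al + be theta, whose norm is the product of the two
    values of g.  Dividing by k modulo b^2 gives the claim. *)
Lemma norm_represents g k x0 y0 x y : has_disc g ->
    value g x0 y0 = k ^+ 2 -> coprimep k b ->
  exists x' y', b ^+ 2 %| value (Bqf 1 b Delta) x' y' - value g x y.
Proof.
move=> [bg [t Et]] gk cop.
have /Bezout_eq1_coprimepP[[u v] /= uv] := coprimep_expr 2 cop.
pose al := qa g * x0 * x + (b + t) * x0 * y + t * y0 * x + qc g * y0 * y.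
pose be := x0 * y + y0 * x.
exists (u * al), (u * be).
have key : value (Bqf 1 b Delta) al be = k ^+ 2 * value g x y.
  have De : Delta = qa g * qc g + t ^+ 2 + b * t.
    rewrite -addrA -/(phi b t) -Et; char2_ring two0.
  by rewrite -gk /value /bqf_eval /= De bg /al /be; char2_ring two0.
have -> : value (Bqf 1 b Delta) (u * al) (u * be) = u ^+ 2 * value (Bqf 1 b Delta) al be.
  by rewrite /value /bqf_eval; ring.
rewrite key; apply/dvdpP.
exists (v * (u * k + 1) * value g x y).
transitivity ((u * k + v * b ^+ 2 - u * k) * (u * k + 1) * value g x y); last by ring.
by rewrite uv; char2_ring two0.
Qed.

(** Multiplication by x + y theta maps (x0, y0) to (al, be) and multiplies the
    value of g by the norm of x + y theta. *)
Lemma represents_norm g k x0 y0 x y : has_disc g ->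
    value g x0 y0 = k ^+ 2 -> coprimep k b ->
  exists x' y', b ^+ 2 %| value g x' y' - value (Bqf 1 b Delta) x y.
Proof.
move=> [bg [t Et]] gk cop.
have /Bezout_eq1_coprimepP[[u v] /= uv] := coprimep_expr 2 cop.
pose al := x * x0 + y * (t * x0 + qc g * y0).
pose be := x * y0 + y * (qa g * x0 + (b + t) * y0).
exists (u * al), (u * be); set N := value (Bqf 1 b Delta) x y.
have key : value g al be = k ^+ 2 * N.
  have De : Delta = qa g * qc g + t ^+ 2 + b * t.
    rewrite -addrA -/(phi b t) -Et; char2_ring two0.
  by rewrite -gk /N /value /bqf_eval /= De bg /al /be; char2_ring two0.
have -> : value g (u * al) (u * be) = u ^+ 2 * value g al be.
  by rewrite /value /bqf_eval; ring.
rewrite key; apply/dvdpP; exists (v * (u * k + 1) * N).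
transitivity ((u * k + v * b ^+ 2 - u * k) * (u * k + 1) * N); last by ring.
by rewrite uv; char2_ring two0.
Qed.

Lemma omega_sub f g : qb g != 0 -> primitive g ->
    (forall x y, exists x' y', b ^+ 2 %| value g x' y' - value f x y) ->
  (omega b (class_of G f) `<=` omega b (class_of G g))%classic.
Proof.
move=> g0 prg H r [ur [f' [m [[_ ef'] rm [x [y Em]]]]]]; split=> //.
have [x1 [y1 E1]] := proper_equiv_value two0 ef' x y.
have [x2 [y2 E2]] := H x1 y1.
exists g, (value g x2 y2); split; last by exists x2, y2.
  by split=> //; apply: (proper_equiv_refl two0 subG).
case: ur rm => m0 _ <-; rewrite /residue /= => rm.
have -> : value g x2 y2 - m0 = (value g x2 y2 - value f x1 y1) + (m - m0).
  by rewrite -E1 Em /value; ring.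
by rewrite dvdp_add.
Qed.

Lemma primitive_norm : primitive (Bqf 1 b Delta).
Proof. by apply: (@bezout_primitive _ _ 1 0 0); rewrite /=; ring. Qed.

Lemma omega_square g k x0 y0 : has_disc g -> primitive g ->
    value g x0 y0 = k ^+ 2 -> coprimep k b ->
  omega b (class_of G g) = H_sub G b Delta.
Proof.
move=> dg prg gk cop; apply/predeqP => r; split; apply: omega_sub.
- by [].
- exact: primitive_norm.
- by move=> x y; apply: norm_represents gk cop.
- by case: dg => ->.
- by [].
- by move=> x y; apply: represents_norm gk cop.
Qed.

Lemma class_groupP f : primitive f -> has_disc f ->
  class_group G b Delta (class_of G f).
Proof. by move=> prim [bf df]; exists f. Qed.

Lemma omega_kernel_squares : ~ (exists t, Delta = phi b t) ->
  omega_kernel G b Delta = class_squares G b Delta.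
Proof.
move=> nphi; apply/predeqP => C; split.
  move=> [[f0 [pr0 b0 d0] <-] eH].
  have df0 : has_disc f0 by split.
  have : H_sub G b Delta (residue b 1).
    split; first by exists 1 => //; exists 1; rewrite /= mulr1 subrr dvdp0.
    exists (Bqf 1 b Delta), 1; split; last by exists 1, 0; rewrite /bqf_eval /=; ring.
      by split; [exact: primitive_norm | exact: (proper_equiv_refl two0 subG)].
    by rewrite /residue /= subrr dvdp0.
  rewrite -eH => -[_ [f [m [[pr ef] /= dm [x [y Em]]]]]].
  have df := has_disc_equiv df0 ef; have [bf _] := df.
  have bf0 : qb f != 0 by rewrite bf.
  have [|x1 [y1 [u1 [v1 [h [bez1 dv1 cop1]]]]]] := @primitive_point f x y bf0.
    by rewrite bf /value -Em.
  have [m2 [x2 [y2 [u2 [v2 [bez2 val2 cop2]]]]]] := represents_square bf0 bez1 dv1 cop1.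
  have [g [k [fk prg bg gk gm]]] := square_value_equiv bf0 bez2 val2 cop2.
  have dk := has_disc_equiv df fk.
  have dg : has_disc g by apply: has_disc_mulE dk _ _; rewrite ?bg.
  have f0k : f0 =~ k by apply: (proper_equiv_trans two0 subG _ ef fk); rewrite b0.
  exists (class_of G g); first exact: class_groupP.
  rewrite (class_mul_self nphi dg prg gk); symmetry.
  by apply: (class_of_eq two0 subG _ f0k); rewrite b0.
move=> [_ [f [pr bf df] <-] <-].
have dsf : has_disc f by split.
have bf0 : qb f != 0 by rewrite bf.
have [g [h [k [x [y [fg gh prh gm [hk cop]]]]]]] := square_composition bf0 pr.
have dg := has_disc_equiv dsf fg; have [bg _] := dg.
have dh : has_disc h.
  by apply: has_disc_mulE dg _ gm; have [<- _] := composes_qb gh.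
have prg := proper_equiv_primitive two0 fg pr.
rewrite (class_of_eq two0 subG bf0 fg) (class_mul_self nphi dg prg gh).
split; first exact: class_groupP.
by apply: omega_square dh prh hk _; rewrite -bf.
Qed.

End Discriminant.
End Genus.

Theorem theorem3p4 (n : nat) (F : finFieldType) (cardF : #|F| = (2 ^ n)%N)
    (G : {set F}) (subG : GRing.zmod_closed G) (cardG : #|G| = (2 ^ n.-1)%N)
    (notin1 : 1 \notin G)
    (b Delta : {poly F}) (b_neq0 : b != 0)
    (notin_phi : ~ (exists t : {poly F}, Delta = phi b t)) :
  omega_kernel G b Delta = class_squares G b Delta.
Proof. exact: (omega_kernel_squares cardF). Qed.
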